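(* Let $G$ be an irreducible finite complex reflection group. Then $G$ has a decomposition as a direct product $G=Z\times\hat{G}$ of subgroups, where $Z\subseteq ZG$ and where $\hat{G}$ is indecomposable non-abelian or trivial. In this decomposition the subgroup $Z$ is unique.
   Context: $ZG$ is the center of $G$. A group is indecomposable if it admits no non-trivial decomposition as a direct product. A finite complex reflection group is a finite subgroup of $\mathrm{GL}(V)$, $V$ a finite-dimensional complex vector space, generated by (pseudo-)reflections; it is irreducible if it acts irreducibly on $V$. *)

(* Defs.v *)
From mathcomp Require Import all_boot all_order all_algebra all_fingroup.
From mathcomp Require Import all_solvable mxrepresentation.
From mathcomp Require Import reals complex.

Set Implicit Arguments.
Unset Strict Implicit.
Unset Printing Implicit Defensive.

Import GroupScope GRing.Theory.

(* A finite subgroup of GL(V), with dim V = n, is given by a finite group G   *)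
(* and a faithful representation rG of G on the row space C^n (acting on the  *)
(* right), through which G is identified with its image in GL_n(C).           *)

Section ReflectionGroups.

Variables (C : fieldType) (gT : finGroupType) (G : {group gT}) (n : nat).
Implicit Type rG : mx_representation C G n.

(* The fixed space {v | v *m A = v} of A is a hyperplane. *)
Definition is_pseudo_reflection (A : 'M[C]_n) : bool :=
  (\rank (eigenspace A 1%R)).+1 == n.

Definition pseudo_reflections rG : {set gT} :=
  [set g in G | is_pseudo_reflection (rG g)].

Definition is_reflection_group rG : Prop :=
  mx_faithful rG /\ <<pseudo_reflections rG>> = G.

(* mx_irreducible includes n != 0. *)
Definition is_irreducible_reflection_group rG : Prop :=
  is_reflection_group rG /\ mx_irreducible rG.

End ReflectionGroups.

Definition indecomposable (gT : finGroupType) (G : {group gT}) : Prop :=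
  forall H K : {group gT}, H \x K = G -> H :=: 1 \/ K :=: 1.

Definition central_decomposition (gT : finGroupType) (G Z Ghat : {group gT}) :
    Prop :=
  [/\ Z \x Ghat = G, Z \subset 'Z(G)
    & (indecomposable Ghat /\ ~~ abelian Ghat) \/ Ghat :=: 1].

(* Main.v *)
(* If [G = H \x K] and [g = h * k] is a reflection ([h] in [H], [k] in [K]),
   then [H] or [K] acts by scalars. Indeed, when [K] centralises [g] it
   preserves the line which is the image of [g - 1], so it acts by scalars on
   that line, and irreducibility propagates this to the whole space; likewise
   for [H]. One of the two cases holds, since if [h] is not central in [H] then
   [k] must be scalar. Hence a decomposition [Z \x Ghat] with [Z] central and
   [Ghat] of minimal order has [Ghat] indecomposable, or abelian.
   For uniqueness, ['Z(G) = Z' \x 'Z(Ghat')] is cyclic, so the two factors have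
   coprime orders and [Z] is the product of [D = 'O_pi(Z)], which lies in
   ['Z(Ghat')], and a subgroup of [Z'], for [pi] the set of primes of
   ['Z(Ghat')]. As [D] is a direct factor of [G] it is one of the
   indecomposable nonabelian group [Ghat'], so [D = 1]. *)
Require Import Defs.
From mathcomp Require Import all_boot all_order all_algebra all_fingroup.
From mathcomp Require Import all_solvable mxrepresentation.
From mathcomp Require Import reals complex.

Set Implicit Arguments.
Unset Strict Implicit.
Unset Printing Implicit Defensive.

Import GroupScope GRing.Theory.

(** * Scalar action forced by reflections and irreducibility *)

Section Scalars.

Variables (F : fieldType) (gT : finGroupType) (G : {group gT}) (n : nat).

Local Open Scope ring_scope.

(** The row space of [L] is a line spanned by one nonzero row, which stability makes an eigenvector
    of [A]. *)
Lemma rank1_stable_eigen m (L : 'M[F]_(m, n)) (A : 'M_n) :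
  \rank L = 1%N -> (L *m A <= L)%MS -> exists mu, L *m A = mu *: L.
Proof.
move=> rL stabL; set u := nz_row L.
have eqLu : (L :=: u)%MS.
  apply/eqmxP; rewrite andbC -(geq_leqif (mxrank_leqif_eq _)) ?nz_row_sub //.
  by rewrite rL lt0n mxrank_eq0 nz_row_eq0 -mxrank_eq0 rL.
have /sub_rVP[mu uA] : (u *m A <= u)%MS.
  by rewrite -(eqmxMr A eqLu) -eqLu.
have /submxP[D ->] : (L <= u)%MS by rewrite eqLu.
by exists mu; rewrite -mulmxA uA scalemxAr.
Qed.

Lemma rank_pseudo_reflection (A : 'M[F]_n) :
  is_pseudo_reflection A -> \rank (A - 1%:M) = 1%N.
Proof.
rewrite /is_pseudo_reflection /eigenspace mxrank_ker => /eqP.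
have := rank_leq_row (A - 1%:M); set r := \rank _ => le_rn eq_n.
by apply/eqP; rewrite -(eqn_add2l (n - r)) subnK // addn1 eq_n.
Qed.

Variable rG : mx_representation F G n.

(** For [y = a * c] with [a] in [H] and [c] commuting with [x], the translate of [U] by [y] lies in
    that by [c], where [x] still acts as [mu]. These translates span a nonzero submodule, hence
    everything. *)
Lemma eigen_submodule_scalar m (U : 'M[F]_(m, n)) (H : {group gT}) x mu :
    mx_irreducible rG -> x \in G -> H \subset G ->
    (G \subset H * 'C[x])%g -> U != 0 ->
    (forall y, y \in H -> (U *m rG y <= U)%MS) ->
  U *m rG x = mu *: U -> rG x = mu%:M.
Proof.
move=> /mx_irrP[_ irrG] Gx sHG defG nzU stabU Ux.
pose W : 'M_n := (\sum_(y in G) <<U *m rG y>>)%MS.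
have modW : mxmodule rG W.
  apply/mxmoduleP=> z Gz; rewrite sumsmxMr; apply/sumsmx_subP=> y Gy.
  rewrite (eqmxMr _ (genmxE _)) -mulmxA -repr_mxM //.
  by apply: (sumsmx_sup (y * z)%g); rewrite ?groupM ?genmxE.
have nzW : W != 0.
  apply: contraNneq nzU => W0; rewrite -submx0 -W0.
  by apply: (sumsmx_sup 1%g); rewrite ?group1 // genmxE repr_mx1 mulmx1.
have sW : (W <= kermx (rG x - mu%:M))%MS.
  apply/sumsmx_subP=> y Gy; rewrite genmxE; apply/sub_kermxP.
  have /mulsgP[a c Ha cxc defy] := subsetP defG y Gy.
  have Ga := subsetP sHG a Ha.
  have Gc : c \in G by rewrite -(groupMl _ Ga) -defy.
  have /submxP[D defD] := stabU a Ha.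
  have -> : rG y = rG a *m rG c by rewrite defy repr_mxM.
  rewrite mulmxBr mul_mx_scalar -!mulmxA -(repr_mxM rG Gc Gx).
  have -> : (c * x)%g = (x * c)%g by apply: cent1P.
  rewrite repr_mxM // !mulmxA defD -(mulmxA D U (rG x)) Ux.
  by rewrite -scalemxAr -scalemxAl subrr.
have /eqP : (rG x - mu%:M) == 0.
  rewrite -[_ - _]mul1mx; apply/eqP/sub_kermxP/(submx_trans _ sW).
  by rewrite sub1mx irrG.
by move/subr0_eq.
Qed.

Lemma repr_sub1_commute x y :
    x \in G -> y \in G -> commute x y ->
  (rG x - 1%:M) *m rG y = rG y *m (rG x - 1%:M).
Proof.
move=> Gx Gy cxy.
by rewrite mulmxBl mulmxBr mul1mx mulmx1 -!repr_mxM // cxy.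
Qed.

Lemma reflection_centraliser_scalar (K : {group gT}) g :
    mx_irreducible rG -> K \subset G -> (G \subset K * 'C(K))%g ->
    g \in pseudo_reflections rG -> g \in 'C(K)%g ->
  {in K, forall x, is_scalar_mx (rG x)}.
Proof.
move=> irrG sKG defG /setIdP[Gg /rank_pseudo_reflection rL] cKg x Kx.
have stabL y : y \in K -> ((rG g - 1%:M) *m rG y <= rG g - 1%:M)%MS.
  move=> Ky; have Gy := subsetP sKG y Ky.
  rewrite repr_sub1_commute ?submxMl //.
  exact: (centP cKg y Ky).
have [mu Lx] := rank1_stable_eigen rL (stabL x Kx).
apply/is_scalar_mxP; exists mu.
apply: eigen_submodule_scalar stabL Lx => //; first exact: (subsetP sKG).
  apply: subset_trans defG _; apply: mulgS; rewrite -cent_set1.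
  by apply: centS; rewrite sub1set.
by rewrite -mxrank_eq0 rL.
Qed.

(* If [h] does not commute with some [a] in [H], then [k] acts as a single
   scalar on the image of [g - 1] and on its translate by [a], hence on the
   nonzero [K]-stable image of [[~ g, a] - 1 = [~ h, a] - 1]. *)
Lemma reflection_component_scalar (H K : {group gT}) h k :
    mx_faithful rG -> mx_irreducible rG -> (H \x K = G)%g ->
    h \in H -> k \in K -> (h * k)%g \in pseudo_reflections rG ->
  h \notin 'C(H)%g -> is_scalar_mx (rG k).
Proof.
move=> ffulG irrG /dprodP[_ defG cHK _] Hh Kk /setIdP[].
set g := (h * k)%g => Gg /rank_pseudo_reflection rL.
have sHG : H \subset G by rewrite -defG mulG_subl.
have sKG : K \subset G by rewrite -defG mulG_subr.
rewrite -sub_cent1 => /subsetPn[a Ha nca].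
have Ga := subsetP sHG a Ha; have Gk := subsetP sKG k Kk.
have cHy x y : x \in H -> y \in K -> commute x y.
  by move=> Hx Ky; apply/commute_sym/(centsP cHK).
have [|mu Lk] := rank1_stable_eigen (A := rG k) rL.
  rewrite repr_sub1_commute ?submxMl //.
  by apply/commute_sym/commuteM => //; apply/commute_sym/cHy.
have defc : [~ g, a] = [~ h, a].
  have /commgP/eqP ka1 : commute k a by apply/commute_sym/cHy.
  have /commgP/conjg_fixP hk : commute [~ h, a] k by apply: cHy; rewrite ?groupR.
  by rewrite commMgJ hk ka1 mulg1.
clearbody g; have Hc : [~ g, a] \in H by rewrite defc groupR.
have Gc := subsetP sHG _ Hc.
apply/is_scalar_mxP; exists mu.
apply: (eigen_submodule_scalar (U := rG [~ g, a] - 1%:M) (H := K)) => //.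
- rewrite -defG -(normC (subset_trans cHK (cent_sub _))); apply: mulgS.
  by rewrite sub_cent1 (subsetP _ k Kk).
- apply: contra nca; rewrite subr_eq0 -(repr_mx1 rG) => /eqP.
  move/(mx_faithful_inj ffulG)=> c1.
  by apply/cent1P/commute_sym/commgP; rewrite -defc c1.
- move=> y Ky; have Gy := subsetP sKG y Ky.
  rewrite repr_sub1_commute ?submxMl //.
  exact: cHy.
have Lak : rG a^-1%g *m (rG g - 1%:M) *m rG a *m rG k
         = mu *: (rG a^-1%g *m (rG g - 1%:M) *m rG a).
  rewrite -(mulmxA _ (rG a)) -(repr_mxM rG Ga Gk) (cHy a k) //.
  rewrite (repr_mxM rG Gk Ga) mulmxA.
  by rewrite -(mulmxA _ _ (rG k)) Lk -scalemxAr -scalemxAl.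
have defLa : rG (g ^ a)%g - 1%:M = rG a^-1%g *m (rG g - 1%:M) *m rG a.
  rewrite conjgE !repr_mxM ?groupM ?groupV // mulmxBr mulmx1 mulmxBl mulmxA.
  by rewrite -[rG a^-1%g *m rG a]repr_mxM ?groupV // mulVg repr_mx1.
(* Since [[~ g, a]] is [g^-1 * g ^ a], the scalar actions of [k] on the images of [g ^ a - 1] and
   [g - 1] combine linearly. *)
have -> : rG [~ g, a] - 1%:M
    = rG g^-1%g *m ((rG (g ^ a)%g - 1%:M) - (rG g - 1%:M)).
  rewrite commgEl repr_mxM ?groupV ?groupJ // opprB addrA subrK mulmxBr.
  by rewrite -[rG g^-1%g *m rG g]repr_mxM ?groupV // mulVg repr_mx1.
by rewrite defLa -(mulmxA (rG g^-1%g)) mulmxBl Lak Lk -scalerBr -scalemxAr.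
Qed.

Lemma faithful_scalar_center x :
  mx_faithful rG -> x \in G -> is_scalar_mx (rG x) -> x \in 'Z(G)%g.
Proof.
move=> ffulG Gx /is_scalar_mxP[mu rGx]; apply/centerP; split=> // y Gy.
apply: (mx_faithful_inj ffulG); rewrite ?groupM //.
by rewrite !repr_mxM // rGx scalar_mxC.
Qed.

Lemma reflection_group_dprod (H K : {group gT}) :
    mx_faithful rG -> mx_irreducible rG -> <<pseudo_reflections rG>>%g = G ->
    (H \x K = G)%g ->
  H \subset 'Z(G)%g \/ K \subset 'Z(G)%g.
Proof.
move=> ffulG irrG genG dprodG.
have [_ defG cHK _] := dprodP dprodG.
have sHG : H \subset G by rewrite -defG mulG_subl.
have sKG : K \subset G by rewrite -defG mulG_subr.
(* One reflection is enough to decide; without any, [G] is trivial. *)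
have [refl0 | [g refl_g]] := set_0Vmem (pseudo_reflections rG).
  by left; rewrite (subset_trans sHG) // -genG refl0 gen0 sub1G.
have /mulsgP[h k Hh Kk defg] : g \in (H * K)%g.
  by rewrite defG; case/setIdP: refl_g.
(* If [h] is central in [H], then [g] centralises [H]; otherwise [k] is central in [G] and [g]
   centralises [K]. *)
have [cHh | ncHh] := boolP (h \in 'C(H)%g); [left | right].
  apply/subsetP=> x Hx; apply: faithful_scalar_center => //.
    exact: (subsetP sHG).
  apply: (reflection_centraliser_scalar irrG sHG _ refl_g) => //.
    by rewrite -defG mulgS.
  by rewrite defg groupM // (subsetP cHK).
rewrite defg in refl_g.
have Zk : k \in 'Z(G)%g.
  apply: faithful_scalar_center => //; first exact: (subsetP sKG).
  exact: reflection_component_scalar dprodG Hh Kk refl_g ncHh.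
apply/subsetP=> x Kx; apply: faithful_scalar_center => //.
  exact: (subsetP sKG).
apply: (reflection_centraliser_scalar irrG sKG _ refl_g) => //.
  by rewrite -defG -(normC (subset_trans cHK (cent_sub _))) mulgS // centsC.
rewrite groupM ?(subsetP _ h Hh) 1?centsC //.
by case/setIP: Zk => _; apply: (subsetP (centS sKG)).
Qed.

End Scalars.

(** * Direct decompositions with a central factor *)

Section CentralDecompositions.

Variables (gT : finGroupType) (G : {group gT}).

Lemma central_factor_sub (Z Ghat Z' Ghat' : {group gT}) :
    cyclic 'Z(G) -> Z \subset 'Z(G) -> Z' \subset 'Z(G) ->
    Z \x Ghat = G -> Z' \x Ghat' = G ->
    (indecomposable Ghat' /\ ~~ abelian Ghat') \/ Ghat' :=: 1 ->
  Z \subset Z'.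
Proof.
move=> cycZG sZ sZ' defG defG' [[indG' nabG'] | G'1]; last first.
  move: defG'; rewrite G'1 dprodg1 => ->.
  exact: subset_trans sZ (center_sub G).
have defZG := center_dprod defG'.
rewrite (center_idP (abelianS sZ' (center_abelian G))) in defZG.
pose pi : nat_pred := \pi('Z(Ghat')).
have co : coprime #|Z'| #|'Z(Ghat')|.
  rewrite -(cyclic_dprod defZG) ?(cyclicS _ cycZG) //.
  by rewrite -(dprodW defZG) mulG_subr.
(* Hence [Z'] contains every [pi^']-subgroup of ['Z(G)], and ['Z(Ghat')] every [pi]-subgroup. *)
have [hallZ' hallG'] : pi^'.-Hall('Z(G)) Z' /\ pi.-Hall('Z(G)) 'Z(Ghat').
  apply: coprime_mulGp_Hall (dprodW defZG) _ (pgroup_pi _).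
  by rewrite /pgroup /pi -coprime_pi' ?cardG_gt0 // coprime_sym.
have nrmZG (A : {group gT}) : A \subset 'Z(G) -> A <| 'Z(G).
  by move=> sA; rewrite /normal sA (sub_abelian_norm (center_abelian G)).
have defZ := nilpotent_pcoreC pi (abelian_nil (abelianS sZ (center_abelian G))).
have [D1 | ntD] := eqVneq 'O_pi(Z) 1.
  rewrite -{1}defZ D1 dprod1g (sub_normal_Hall hallZ') ?nrmZG ?pcore_pgroup //.
  exact: subset_trans (pcore_sub _ _) sZ.
have sDZG' : 'O_pi(Z) \subset 'Z(Ghat').
  rewrite (sub_normal_Hall hallG') ?nrmZG ?(pHall_sub hallG') ?pcore_pgroup //.
  exact: subset_trans (pcore_sub _ _) sZ.
have sDG' := subset_trans sDZG' (center_sub Ghat').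
move: defG; rewrite -{1}defZ -dprodA => defG.
have [[_ M _ defM] _ _ _] := dprodP defG.
have sG'G : Ghat' \subset G by rewrite -(dprodW defG') mulG_subr.
(* By the modular law, the direct factor ['O_pi(Z)] of [G] splits off from [Ghat']. *)
have := dprod_modl defG sDG'; rewrite (setIidPr sG'G) defM => defGhat'.
case: (indG' _ _ defGhat') => /= [D1 | M1]; first by rewrite D1 eqxx in ntD.
case/negP: nabG'.
by rewrite -defGhat' M1 dprodg1 (abelianS sDZG') ?center_abelian.
Qed.

Lemma central_decomposition_exists :
    (forall H K : {group gT}, H \x K = G ->
      H \subset 'Z(G) \/ K \subset 'Z(G)) ->
  exists Z Ghat : {group gT}, central_decomposition G Z Ghat.
Proof.
move=> splitG.
pose P (A : {group gT}) :=
  [exists Z : {group gT}, (Z \x A == G) && (Z \subset 'Z(G))].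
have P_G : P G by apply/existsP; exists 1%G; rewrite dprod1g eqxx sub1G.
case: (arg_minnP (fun A : {group gT} => #|A|) P_G) => Ghat.
case/existsP=> Z /andP[/eqP defG sZ] minG.
have [abG | nabG] := boolP (abelian Ghat).
  have cGG : abelian G.
    rewrite -(dprodW defG) abelianM abG (abelianS sZ (center_abelian G)).
    by have [] := dprodP defG.
  by exists G, 1%G; split; rewrite ?dprodg1 ?(center_idP cGG) //; right.
exists Z, Ghat; split=> //; left; split=> // H K defGhat.
(* A central factor [A] of [Ghat] can be moved into [Z], leaving [B] as complement; minimality of
   [Ghat] then forces [A] to be trivial. *)
have absorb (A B : {group gT}) :
    A \x B = Ghat -> A \subset 'Z(G) -> A :=: 1.
  move=> defAB sA; move: defG; rewrite -defAB dprodA => defG'.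
  have [[ZA B' defZA defB] _ _ _] := dprodP defG'.
  have: #|Ghat| <= #|B|.
    apply: minG; apply/existsP; exists ZA.
    by rewrite -{1}defZA defG' eqxx -(dprodW defZA) mul_subG.
  rewrite -(dprod_card defAB) -[leqRHS]mul1n leq_pmul2r ?cardG_gt0 //.
  exact: card_le1_trivg.
move: (defG); rewrite -defGhat dprodA => defG'.
have [[ZH _ defZH _] _ _ _] := dprodP defG'.
rewrite defZH in defG'.
case: (splitG _ _ defG') => [sZH | sK].
  left; apply: (absorb H K) => //; apply: subset_trans sZH.
  by rewrite -(dprodW defZH) mulG_subr.
by right; apply: (absorb K H); rewrite // dprodC.
Qed.

End CentralDecompositions.

Theorem proposition1p10 (R : realType) (gT : finGroupType) (G : {group gT})
    (n : nat) (rG : mx_representation R[i]%C G n) :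
  is_irreducible_reflection_group rG ->
  exists! Z : {group gT},
    exists Ghat : {group gT}, central_decomposition G Z Ghat.
Proof.
case=> -[ffulG genG] irrG.
(* By Schur's lemma the center embeds in the multiplicative group of a field. *)
have cycZG := mx_faithful_irr_center_cyclic ffulG irrG.
have [|Z [Ghat decG]] := @central_decomposition_exists _ G.
  by move=> H K; apply: reflection_group_dprod ffulG irrG genG.
exists Z; split; first by exists Ghat.
move=> Z' [Ghat' [defG' sZ' indG']]; have [defG sZ indG] := decG.
apply/val_inj/eqP; rewrite eqEsubset /=.
by rewrite (central_factor_sub cycZG sZ sZ' defG defG' indG')
           (central_factor_sub cycZG sZ' sZ defG' defG indG).
Qed.
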